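(* Let $N\ge2$, $p\ge1$, and let $A=(a_{ij})_{i,j=0}^{N-1}$ be an $N\times N$ unitary matrix with $a_{0j}=1/\sqrt N$ for all $j$. Then $$\overline A^{\otimes p}=\prod_{k=0}^{p-1}\big(I_{N^k}\otimes\overline A\otimes I_{N^{p-1-k}}\big)$$ (product written from left to right with $k=0$ leftmost), and each factor has at most $N$ non-zero entries in each row and each column. Moreover, for a vector $v\in\mathbb C^{N^p}$, set $v^{(p)}=v$ and, for $k=p-1,p-2,\dots,0$, $$v^{(k)}(i_1+N^ki_2+N^{k+1}i_3)=\sum_{j_2=0}^{N-1}\overline{a_{i_2j_2}}\;v^{(k+1)}(i_1+N^kj_2+N^{k+1}i_3)$$ for $0\le i_1\le N^k-1$, $0\le i_2\le N-1$, $0\le i_3\le N^{p-1-k}-1$. Then $v^{(0)}=\overline A^{\otimes p}v$. Consequently $\overline A^{\otimes p}v$ can be computed using at most $N^p\cdot p\cdot N$ operations, which for fixed $N$ and $M=N^p$ is $O(M\log M)$ operations.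
   Context: An operation means one multiplication and one addition of complex numbers. $I_n$ is the $n\times n$ identity matrix, $\overline A$ is the entrywise complex conjugate of $A$, and vectors and matrices are indexed from $0$. Tensor product convention: for $C$ of size $n\times n$ and $D$ of size $m\times m$, $C\otimes D$ is the $nm\times nm$ matrix with $(C\otimes D)_{i_1+ni_2,\,j_1+nj_2}=C_{i_1j_1}D_{i_2j_2}$ for $0\le i_1,j_1\le n-1$, $0\le i_2,j_2\le m-1$; this operation is associative. $C^{\otimes1}=C$, $C^{\otimes p}=C\otimes C^{\otimes(p-1)}$. *)

(* Defs.v *)
From mathcomp Require Import all_boot all_order all_algebra.
From mathcomp Require Import all_classical all_reals all_analysis.
From mathcomp Require Import complex mxtens.

Set Implicit Arguments.
Unset Strict Implicit.
Unset Printing Implicit Defensive.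

Import Order.TTheory GRing.Theory Num.Theory.
Import numFieldNormedType.Exports.

Local Open Scope ring_scope.

Section TensorProduct.
Context {C : comPzRingType}.

(* In this convention the index of the LEFT factor varies fastest
   (see kronE), whereas mxtens_index (i, j) = i * n + j makes the index of the
   right factor vary fastest; hence the swap. *)
Definition kron n m (A : 'M[C]_n) (B : 'M[C]_m) : 'M[C]_(n * m) :=
  castmx (mulnC m n, mulnC m n) (B *t A).

Lemma kronE n m (A : 'M[C]_n) (B : 'M[C]_m) (i j : 'I_(n * m))
    (i1 j1 : 'I_n) (i2 j2 : 'I_m) :
  i = (i1 + n * i2)%N :> nat -> j = (j1 + n * j2)%N :> nat ->
  kron A B i j = A i1 j1 * B i2 j2.
Proof.
move=> iE jE; rewrite /kron castmxE mulrC -tensmxE.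
by congr (_ _ _); apply/val_inj; rewrite /= ?iE ?jE addnC mulnC.
Qed.

Lemma kron_pow_subproof n p : (n * n ^ p = n ^ p.+1)%N.
Proof. by rewrite expnS. Qed.

(* For p = 0 this is the empty tensor product; 'M_(n ^ 1) is convertible to
   'M_n. *)
Fixpoint kron_pow n (A : 'M[C]_n) (p : nat) : 'M[C]_(n ^ p) :=
  match p with
  | 0 => 1%:M
  | q.+1 => match q return 'M[C]_(n ^ q) -> 'M[C]_(n ^ q.+1) with
            | 0 => fun=> A
            | _ => fun Aq => castmx (kron_pow_subproof n _,
                                     kron_pow_subproof n _) (kron A Aq)
            end (kron_pow A q)
  end.

Lemma kron_factor_subproof N p (k : 'I_p) :
  (N ^ k * N * N ^ (p.-1 - k) = N ^ p)%N.
Proof.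
rewrite -expnSr -expnD; congr (_ ^ _)%N.
by case: p k => [[]//|p] k /=; rewrite addSn subnKC // -ltnS.
Qed.

Definition kron_factor N p (B : 'M[C]_N) (k : 'I_p) : 'M[C]_(N ^ p) :=
  castmx (kron_factor_subproof N k, kron_factor_subproof N k)
    (kron (kron (1%:M : 'M[C]_(N ^ k)) B) (1%:M : 'M[C]_(N ^ (p.-1 - k)))).

End TensorProduct.

Lemma radix_index_subproof N p (k : 'I_p)
    (i1 : 'I_(N ^ k)) (i2 : 'I_N) (i3 : 'I_(N ^ (p.-1 - k))) :
  (i1 + N ^ k * i2 + N ^ k.+1 * i3 < N ^ p)%N.
Proof.
rewrite -(kron_factor_subproof N k) -expnSr.
have h12 : (i1 + N ^ k * i2 < N ^ k.+1)%N.
  rewrite expnSr (@leq_trans (N ^ k + N ^ k * i2)) ?ltn_add2r //.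
  by rewrite -mulnS leq_mul2l ltn_ord orbT.
rewrite (@leq_trans (N ^ k.+1 + N ^ k.+1 * i3)) ?ltn_add2r //.
by rewrite -mulnS leq_mul2l ltn_ord orbT.
Qed.

Definition radix_index N p (k : 'I_p)
    (i1 : 'I_(N ^ k)) (i2 : 'I_N) (i3 : 'I_(N ^ (p.-1 - k))) : 'I_(N ^ p) :=
  Ordinal (radix_index_subproof i1 i2 i3).

(* Only the values w 0, ..., w p are constrained, and they are determined by
   v because radix_index is a bijection for each k. *)
Definition recursion_of {C : pzRingType} N p (B : 'M[C]_N)
    (v : 'cV[C]_(N ^ p)) (w : nat -> 'cV[C]_(N ^ p)) : Prop :=
  w p = v /\
  forall (k : 'I_p) i1 i2 i3,
    w k (radix_index (k := k) i1 i2 i3) 0 =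
      \sum_(j2 < N) B i2 j2 * w k.+1 (radix_index (k := k) i1 j2 i3) 0.

(* Computations are straight-line programs: the n-th instruction (x, y, z)
   stores x * y + z as the n-th result.  The operands are 0, the entries of a
   given matrix, the entries of the input vector and the earlier results, so
   the number of operations is the number of instructions. *)
Inductive operand (N m : nat) :=
  | Zero
  | Coef of 'I_N & 'I_N
  | Input of 'I_m
  | Result of nat.

Definition instruction N m : Type := operand N m * operand N m * operand N m.

Section Programs.
Context {C : pzRingType} {N m : nat} (B : 'M[C]_N) (v : 'cV[C]_m).

(* A reference to a result that is not available yet reads as 0. *)
Definition operand_value (results : seq C) (o : operand N m) : C :=
  match o with
  | Zero => 0
  | Coef i j => B i j
  | Input i => v i 0
  | Result n => nth 0 results n
  end.

Definition run (prog : seq (instruction N m)) : seq C :=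
  foldl (fun results '(x, y, z) =>
           rcons results (operand_value results x * operand_value results y
                          + operand_value results z))
        [::] prog.

End Programs.

(* One program, with fixed output locations, must work for every input. *)
Definition computable_within {C : pzRingType} N m l (B : 'M[C]_N)
    (f : 'cV[C]_m -> 'cV[C]_l) (t : nat) : Prop :=
  exists (prog : seq (instruction N m)) (out : 'I_l -> operand N m),
    (size prog <= t)%N /\
    forall v, f v = \col_i operand_value B v (run B v prog) (out i).

(* Main.v *)
Require Import Defs.
From mathcomp Require Import all_boot all_order all_algebra.
From mathcomp Require Import all_classical all_reals all_analysis.
From mathcomp Require Import complex mxtens.

(** In base [N], the [k]-th factor acts on the [k]-th digit of the index only,
    and the Kronecker power has entries [\prod_t B (digit t i) (digit t j)].
    Applying the factors from the last to the first therefore replaces, one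
    digit at a time, a Kronecker delta by an entry of [B], which turns the
    identity into the Kronecker power.  The recursion for [v] is the successive
    application of the factors to [v]; each of its [p] stages uses [N]
    operations for each of the [N ^ p] entries. *)

Set Implicit Arguments.
Unset Strict Implicit.
Unset Printing Implicit Defensive.

Import Order.TTheory GRing.Theory Num.Theory.
Import numFieldNormedType.Exports.

Local Open Scope classical_set_scope.
Local Open Scope ring_scope.

(** * Base-[N] digits of an index *)

Section Digits.
Variables N p : nat.
Implicit Types (k t : 'I_p) (i : 'I_(N ^ p)).

(** The ordinal [k] witnesses [p > 0], and then [0 ^ p = 0] would leave no room for [i]. *)
Lemma base_gt0 k i : (0 < N)%N.
Proof.
case: N i => // i.
have p_gt0 : (0 < p)%N by apply: leq_ltn_trans (ltn_ord k).
by have := leq_ltn_trans (leq0n i) (ltn_ord i); rewrite exp0n.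
Qed.

Lemma low_subproof k i : (i %% N ^ k < N ^ k)%N.
Proof. by rewrite ltn_pmod // expn_gt0 (base_gt0 k i). Qed.

Lemma digit_subproof k i : (i %/ N ^ k %% N < N)%N.
Proof. by rewrite ltn_pmod // (base_gt0 k i). Qed.

Lemma high_subproof k i : (i %/ N ^ k.+1 < N ^ (p.-1 - k))%N.
Proof.
rewrite ltn_divLR ?expn_gt0 ?(base_gt0 k i) // mulnC expnSr.
by rewrite (kron_factor_subproof N k).
Qed.

Definition low k i : 'I_(N ^ k) := Ordinal (low_subproof k i).
Definition digit k i : 'I_N := Ordinal (digit_subproof k i).
Definition high k i : 'I_(N ^ (p.-1 - k)) := Ordinal (high_subproof k i).

Lemma radix_index_eta k i :
  radix_index (k := k) (low k i) (digit k i) (high k i) = i.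
Proof.
apply: val_inj => /=.
rewrite [RHS](divn_eq i (N ^ k)%N) [in RHS](divn_eq (i %/ N ^ k)%N N).
rewrite expnSr divnMA mulnDl -mulnA (mulnC N) [RHS]addnC.
by rewrite [in RHS](addnC (_ * _)%N) addnA; congr (_ + _ + _)%N; apply: mulnC.
Qed.

Section RadixIndex.
Variables (k : 'I_p) (i1 : 'I_(N ^ k)) (i2 : 'I_N) (i3 : 'I_(N ^ (p.-1 - k))).

Lemma low_radix_index : low k (radix_index i1 i2 i3) = i1.
Proof.
apply: val_inj; rewrite /= expnSr -mulnA -addnA -mulnDr addnC mulnC.
by rewrite modnMDl modn_small.
Qed.

Lemma digit_radix_index : digit k (radix_index i1 i2 i3) = i2.
Proof.
apply: val_inj; rewrite /= expnSr -mulnA -addnA -mulnDr (mulnC (N ^ k)%N).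
have N_gt0 : (0 < N)%N by apply: leq_ltn_trans (ltn_ord i2).
by rewrite addnC divnMDl ?expn_gt0 ?N_gt0 // divn_small // addn0 addnC
           mulnC modnMDl modn_small.
Qed.

Lemma high_radix_index : high k (radix_index i1 i2 i3) = i3.
Proof.
apply: val_inj; rewrite /= expnSr divnMA -mulnA -addnA -mulnDr.
have N_gt0 : (0 < N)%N by apply: leq_ltn_trans (ltn_ord i2).
rewrite addnC (mulnC (N ^ k)%N) divnMDl ?expn_gt0 ?N_gt0 //.
by rewrite (divn_small (ltn_ord i1)) addn0 addnC mulnC divnMDl //
           divn_small ?addn0.
Qed.

End RadixIndex.

Definition set_digit k i (j : 'I_N) : 'I_(N ^ p) :=
  radix_index (k := k) (low k i) j (high k i).

(** Digit [t] is read off the residue modulo [N ^ t.+1], which divides [N ^ k]. *)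
Lemma low_digit k t i i' : (t < k)%N -> low k i = low k i' ->
  digit t i = digit t i'.
Proof.
move=> ltk /(congr1 val) /= e; apply: val_inj => /=.
by rewrite !modn_divl -expnS -(modn_dvdm i (dvdn_exp2l N ltk)) e
           modn_dvdm ?dvdn_exp2l.
Qed.

Lemma high_digit k t i i' : (k < t)%N -> high k i = high k i' ->
  digit t i = digit t i'.
Proof.
move=> ltk /(congr1 val) /= e; apply: val_inj => /=.
by rewrite -(subnKC ltk) expnD !divnMA e.
Qed.

Lemma digit_set_digit k t i j :
  digit t (set_digit k i j) = if t == k then j else digit t i.
Proof.
case: eqP => [->|/eqP]; first exact: digit_radix_index.
rewrite -(inj_eq val_inj) neq_ltn => /orP[]lt_tk.
  by apply: low_digit lt_tk _; rewrite low_radix_index.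
by apply: high_digit lt_tk _; rewrite high_radix_index.
Qed.

Lemma digit_inj i i' : (forall t, digit t i = digit t i') -> i = i'.
Proof.
move=> e; apply: val_inj => /=.
rewrite -(modn_small (ltn_ord i)) -(modn_small (ltn_ord i')).
(* The residue modulo [N ^ m] together with digit [m] determines the residue modulo [N ^ m.+1]; at
   [m = p] the residue is the index itself. *)
suff h m : (m <= p)%N -> (i %% N ^ m = i' %% N ^ m)%N by apply: h.
elim: m => [|m IH] lt_mp; first by rewrite !modn1.
have /(congr1 val) /= := e (Ordinal lt_mp); rewrite !modn_divl -expnS => d.
rewrite (divn_eq (i %% _)%N (N ^ m)%N) d modn_dvdm ?dvdn_exp2l // IH 1?ltnW //.
by rewrite [RHS](divn_eq _ (N ^ m)%N) modn_dvdm ?dvdn_exp2l.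
Qed.

End Digits.

Arguments set_digit {N p} k i j.

(** * Entries and sparsity of the Kronecker factors *)

Lemma kron_index_subproof n m (i1 : 'I_n) (i2 : 'I_m) : (i1 + n * i2 < n * m)%N.
Proof.
rewrite (@leq_trans (n + n * i2)) ?ltn_add2r //.
by rewrite -mulnS leq_mul2l ltn_ord orbT.
Qed.

Definition kron_index n m (i1 : 'I_n) (i2 : 'I_m) : 'I_(n * m) :=
  Ordinal (kron_index_subproof i1 i2).

Section KroneckerFactors.
Variables (C : comPzRingType) (N p : nat) (B : 'M[C]_N).
Implicit Types (k t : 'I_p) (i j : 'I_(N ^ p)).

Lemma kron_factorE k i j :
  kron_factor B k i j =
    if (low k i == low k j) && (high k i == high k j)
    then B (digit k i) (digit k j) else 0.
Proof.
rewrite /kron_factor castmxE.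
rewrite (@kronE _ _ _ _ _ _ _ (kron_index (low k i) (digit k i))
               (kron_index (low k j) (digit k j)) (high k i)
               (high k j)); first last.
- by rewrite -[in LHS](radix_index_eta k j) /= expnSr.
- by rewrite -[in LHS](radix_index_eta k i) /= expnSr.
rewrite (@kronE _ _ _ _ _ _ _ (low k i) (low k j) (digit k i) (digit k j)) //.
rewrite !mxE.
by case: eqP; case: eqP => _ _; rewrite ?mul1r ?mul0r ?mulr1 ?mulr0.
Qed.

Lemma set_digit_digit k i j : low k i = low k j -> high k i = high k j ->
  set_digit k i (digit k j) = j.
Proof. by rewrite /set_digit => -> ->; apply: radix_index_eta. Qed.

(** Row [i] of the factor vanishes outside the indices that differ from [i] at most in digit [k], so
    the sum over [N ^ p] indices collapses to one over the [N] values of that digit. *)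
Lemma mul_kron_factor k r (X : 'M[C]_(N ^ p, r)) i s :
  (kron_factor B k *m X) i s =
    \sum_(j < N) B (digit k i) j * X (set_digit k i j) s.
Proof.
rewrite mxE (eq_bigr (fun j =>
  if (low k i == low k j) && (high k i == high k j)
  then B (digit k i) (digit k j) * X j s else 0)); last first.
  by move=> j _; rewrite kron_factorE; case: ifP; rewrite ?mul0r.
rewrite -big_mkcond (reindex_onto (set_digit k i) (@digit N p k)) /=.
  apply: eq_big => [j|j _]; rewrite digit_radix_index //.
  by rewrite low_radix_index high_radix_index !eqxx.
by move=> j /andP[/eqP ? /eqP ?]; apply: set_digit_digit.
Qed.

(** The support lies in the image of [set_digit k i], a map from a set with [N] elements. *)
Lemma kron_factor_row_support k i :
  (#|[pred j | kron_factor B k i j != 0%R]| <= N)%N.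
Proof.
rewrite -[leqRHS]card_ord -cardsT.
apply: leq_trans (leq_imset_card (set_digit k i) _).
apply/subset_leq_card/fintype.subsetP => j; rewrite inE kron_factorE.
case: ifP => [/andP[/eqP el /eqP eh] _|_ /eqP//].
by rewrite -(set_digit_digit el eh) imset_f.
Qed.

Lemma kron_factor_col_support k j :
  (#|[pred i | kron_factor B k i j != 0%R]| <= N)%N.
Proof.
rewrite -[leqRHS]card_ord -cardsT.
apply: leq_trans (leq_imset_card (set_digit k j) _).
apply/subset_leq_card/fintype.subsetP => i; rewrite inE kron_factorE.
case: ifP => [/andP[/eqP el /eqP eh] _|_ /eqP//].
by rewrite -(set_digit_digit (esym el) (esym eh)) imset_f.
Qed.

End KroneckerFactors.

(** * The Kronecker power as a product of factors *)

Lemma kron_powE (C : comPzRingType) N p (B : 'M[C]_N)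
    (i j : 'I_(N ^ p)) :
  kron_pow B p i j = \prod_(t < p) B (digit t i) (digit t j).
Proof.
elim: p i j => [|[|p] IH] i j.
- by rewrite big_ord0 mxE !ord1 eqxx.
- rewrite big_ord1 /=.
  by congr (B _ _); apply: val_inj; rewrite /= divn1 modn_small.
(* The left factor of [kron] owns the fastest digit: the outer [B] acts on digit [0], the remaining
   power on [high ord0], whose digit [t] is digit [t.+1] of the whole index. *)
rewrite /= castmxE.
rewrite (@kronE _ _ _ _ _ _ _ (digit ord0 i) (digit ord0 j) (high ord0 i)
               (high ord0 j)); first last.
- by rewrite -[in LHS](radix_index_eta ord0 j) /= modn1 mul1n.
- by rewrite -[in LHS](radix_index_eta ord0 i) /= modn1 mul1n.
rewrite big_ord_recl; congr (_ * _).
rewrite [LHS]IH; apply: eq_bigr => t _.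
by congr (B _ _); apply: val_inj => /=;
  rewrite /bump add1n (expnS N t) divnMA expn1.
Qed.

(* [mixed_pow k] interpolates between the identity ([k = p]) and the Kronecker
   power ([k = 0]): the digits below [k] are not touched yet. *)
Definition mixed_pow (C : comPzRingType) N p (B : 'M[C]_N) (k : nat) :
    'M[C]_(N ^ p) :=
  \matrix_(i, j) \prod_(t < p)
    if (t < k)%N then (digit t i == digit t j)%:R
    else B (digit t i) (digit t j).

Lemma mixed_pow_step (C : comPzRingType) N p (B : 'M[C]_N) (k : 'I_p) :
  mixed_pow p B k = kron_factor B k *m mixed_pow p B k.+1.
Proof.
apply/matrixP => i j; rewrite mul_kron_factor mxE (bigD1 k) //= ltnn.
(* In [mixed_pow p B k.+1] digit [k] still carries a Kronecker delta, which kills every term except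
   the one with [d = digit k j]. *)
rewrite [RHS](bigD1 (digit k j)) //= [X in _ + X]big1 ?addr0 => [|d ne_d].
  rewrite mxE [in RHS](bigD1 k) //= ltnSn digit_set_digit eqxx eqxx mul1r.
  congr (_ * _); apply: eq_bigr => t ne_t.
  rewrite digit_set_digit (negPf ne_t) ltnS [in RHS]leq_eqVlt.
  by rewrite -[t == k :> nat]/(t == k) (negPf ne_t).
rewrite mxE (bigD1 k) //= ltnSn digit_set_digit eqxx (negPf ne_d).
by rewrite mul0r mulr0.
Qed.

Lemma mixed_pow_full (C : comPzRingType) N p (B : 'M[C]_N) :
  mixed_pow p B p = 1%:M.
Proof.
apply/matrixP => i j; rewrite !mxE.
have [->|ne_ij] := eqVneq i j.
  by rewrite big1 // => t _; rewrite ltn_ord eqxx.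
have [t ne_t] : exists t, digit t i != digit t j.
  apply/existsP; apply: contraNT ne_ij => /existsPn eq_ij.
  by apply/eqP/digit_inj => t; apply/eqP; rewrite -[_ == _]negbK eq_ij.
by rewrite (bigD1 t) //= ltn_ord (negPf ne_t) mul0r.
Qed.

Lemma mixed_pow0 (C : comPzRingType) N p (B : 'M[C]_N) :
  mixed_pow p B 0 = kron_pow B p.
Proof. by apply/matrixP => i j; rewrite mxE kron_powE. Qed.

(** Stated for any number [r] of columns because it serves twice: for the matrices [mixed_pow] and
    for the vectors of the recursion. *)
Lemma chain_prod (C : pzRingType) m r p (F : 'I_p -> 'M[C]_m)
    (X : nat -> 'M[C]_(m, r)) :
  (forall k : 'I_p, X k = F k *m X k.+1) -> X 0%N = (\prod_(k < p) F k) *m X p.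
Proof.
elim: p F X => [|p IH] F X eqX; first by rewrite big_ord0 mul1mx.
rewrite big_ord_recl (eqX ord0) -mulmxE -mulmxA; congr (_ *m _).
by apply: (IH _ (X \o S)) => k /=; rewrite -[RHS]eqX.
Qed.

(** The chain is prescribed at its end [p], so the induction prepends a new first term to a chain
    for the factors after the first. *)
Lemma exists_chain (C : pzRingType) m r p (F : 'I_p -> 'M[C]_m)
    (v : 'M[C]_(m, r)) :
  exists X : nat -> 'M[C]_(m, r),
    X p = v /\ forall k : 'I_p, X k = F k *m X k.+1.
Proof.
elim: p F => [|p IH] F; first by exists (fun=> v); split=> // -[].
have [X [Xp eqX]] := IH (F \o lift ord0).
exists (fun k => if k is k'.+1 then X k' else F ord0 *m X 0%N); split=> //= k.
by case: (unliftP ord0 k) => [k' ->|->] //=; apply: eqX.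
Qed.

Lemma kron_pow_factorization (C : comPzRingType) N p (B : 'M[C]_N) :
  kron_pow B p = \prod_(k < p) kron_factor B k.
Proof.
rewrite -mixed_pow0 (chain_prod (@mixed_pow_step C N p B)).
by rewrite mixed_pow_full mulmx1.
Qed.

(** * The recursion as successive application of the factors *)

Lemma recursion_ofP (C : comPzRingType) N p (B : 'M[C]_N)
    (v : 'cV[C]_(N ^ p)) w :
  recursion_of B v w <->
  w p = v /\ forall k : 'I_p, w k = kron_factor B k *m w k.+1.
Proof.
split=> -[wp eqw]; split=> // k.
  apply/colP => i; rewrite mul_kron_factor -[in LHS](radix_index_eta k i).
  exact: eqw.
move=> i1 i2 i3; rewrite eqw mul_kron_factor; apply: eq_bigr => j _.
by rewrite /set_digit digit_radix_index low_radix_index high_radix_index.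
Qed.

Lemma exists_recursion (C : comPzRingType) N p (B : 'M[C]_N)
    (v : 'cV[C]_(N ^ p)) : exists w, recursion_of B v w.
Proof.
have [w weq] := exists_chain (fun k : 'I_p => kron_factor B k) v.
by exists w; apply/recursion_ofP.
Qed.

Lemma recursion_kron_pow (C : comPzRingType) N p (B : 'M[C]_N)
    (v : 'cV[C]_(N ^ p)) w :
  recursion_of B v w -> w 0%N = kron_pow B p *m v.
Proof.
move=> /recursion_ofP[<- /chain_prod ->].
by rewrite kron_pow_factorization.
Qed.

(** * Semantics of straight-line programs *)

Section StraightLinePrograms.
Variables (C : pzRingType) (N m : nat) (B : 'M[C]_N) (v : 'cV[C]_m).
Implicit Types (prog : seq (instruction N m)) (o : operand N m).

Definition available n o := if o is Result l then (l < n)%N else true.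

Lemma run_rcons prog x y z :
  run B v (rcons prog (x, y, z)) =
    rcons (run B v prog)
      (operand_value B v (run B v prog) x * operand_value B v (run B v prog) y
       + operand_value B v (run B v prog) z).
Proof. by rewrite /run foldl_rcons. Qed.

Lemma size_run prog : size (run B v prog) = size prog.
Proof.
elim/last_ind: prog => // prog [[x y] z] IH.
by rewrite run_rcons !size_rcons IH.
Qed.

(** Operands available at time [n] point to earlier results only, and appending instructions never
    changes these. Hence they may be evaluated in the final list of results, which turns the run
    into a system of equations. *)
Lemma nth_run d prog n x y z :
  (n < size prog)%N -> nth d prog n = (x, y, z) ->
  available n x -> available n y -> available n z ->
  nth 0 (run B v prog) n =
    operand_value B v (run B v prog) x * operand_value B v (run B v prog) y
    + operand_value B v (run B v prog) z.
Proof.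
move=> + + avx avy avz.
elim/last_ind: prog => // prog [[x' y'] z'] IH.
rewrite size_rcons ltnS run_rcons => le_n nth_n.
set c := (X in rcons _ X).
have keep o : available n o -> operand_value B v (rcons (run B v prog) c) o =
    operand_value B v (run B v prog) o.
  case: o => //= l lt_ln; rewrite nth_rcons size_run.
  by rewrite (leq_trans lt_ln le_n).
rewrite !keep // nth_rcons size_run; move: le_n nth_n.
rewrite leq_eqVlt nth_rcons => /predU1P[->|lt_n].
  by rewrite ltnn eqxx /c => -[-> -> ->].
by rewrite lt_n; apply: IH.
Qed.

End StraightLinePrograms.

(** * A program for the recursion *)

Section RecursionProgram.
Variables (N p : nat).
Local Notation M := (N ^ p)%N.

(* Operand holding the entry [y] of the vector obtained after [s] of the [p]
   stages; stage [s] treats the digit [p - 1 - s]. *)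
Definition stage_operand (s : nat) (y : 'I_M) : operand N M :=
  if s is s'.+1 then Result N M ((s' * M + y) * N + N.-1) else Input N y.

(** The number [l = (s * M + x) * N + j] encodes stage [s], entry [x] and summand [j]. Each block of
    [N] instructions accumulates one sum: it starts from [Zero] at [j = 0] and then adds to the
    preceding result. *)
Definition recursion_instruction (l : 'I_(p * M * N)) : instruction N M :=
  let: (sx, j) := mxtens_unindex l in
  let: (s, x) := mxtens_unindex sx in
  (Coef M (digit (rev_ord s) x) j,
   stage_operand s (set_digit (rev_ord s) x j),
   if j == 0%N :> nat then Zero N M else Result N M l.-1).

Definition recursion_program : seq (instruction N M) :=
  [seq recursion_instruction l | l : 'I_(p * M * N)].

Lemma size_recursion_program : size recursion_program = (N ^ p * p * N)%N.
Proof. by rewrite size_map size_enum_ord (mulnC p). Qed.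

Variables (C : comPzRingType) (B : 'M[C]_N) (v : 'cV[C]_M).
Variable w : nat -> 'cV[C]_M.
Hypothesis w_rec : recursion_of B v w.
Local Notation r := (run B v recursion_program).

Lemma recursion_program_nth (s : 'I_p) (x : 'I_M) (j : 'I_N) :
  nth 0 r ((s * M + x) * N + j) =
    B (digit (rev_ord s) x) j *
      operand_value B v r (stage_operand s (set_digit (rev_ord s) x j))
    + (if j == 0%N :> nat then 0 else nth 0 r ((s * M + x) * N + j.-1)).
Proof.
set l := mxtens_index (mxtens_index (s, x), j).
have lE : l = ((s * M + x) * N + j)%N :> nat by [].
have lK : mxtens_unindex l = (mxtens_index (s, x), j).
  by rewrite /l mxtens_indexK.
rewrite -lE; clearbody l.
have lt_l : (l < size recursion_program)%N.
  by rewrite size_map size_enum_ord ltn_ord.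
have N_gt0 : (0 < N)%N by apply: leq_ltn_trans (ltn_ord j).
rewrite (@nth_run _ _ _ B v (recursion_instruction l) _ _
  (Coef M (digit (rev_ord s) x) j)
  (stage_operand s (set_digit (rev_ord s) x j))
  (if j == 0%N :> nat then Zero N M else Result N M l.-1)) //.
- congr (_ + _); case: ifP => //= /negbT; rewrite -lt0n lE => j_gt0.
  by rewrite -[in LHS](prednK j_gt0) addnS.
- rewrite (nth_map l) ?nth_ord_enum ?size_enum_ord //.
  by rewrite /recursion_instruction lK mxtens_indexK.
(* Since [y < M], the sum for entry [y] of stage [s'] ends before the first instruction of stage
   [s'.+1]. *)
- move: (set_digit _ x j) => y; case: (s : nat) lE => [|s'] //= ->.
  rewrite (@leq_trans ((s' * M + y).+1 * N)) //.
    by rewrite mulSn [X in (_ < X)%N]addnC ltn_add2l ltn_predL.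
  rewrite (leq_trans _ (leq_addr _ _)) // leq_mul2r mulSn.
  by rewrite -addnS addnC -addnA leq_add ?ltn_ord ?orbT // leq_addr.
- case: ifP => //= /negbT; rewrite -lt0n ltn_predL lE => j_gt0.
  by rewrite addn_gt0 j_gt0 orbT.
Qed.

Lemma stage_operand_value s y : (s <= p)%N ->
  operand_value B v r (stage_operand s y) = w (p - s)%N y 0.
Proof.
have /recursion_ofP[w_p w_step] := w_rec.
elim: s y => [|s IH] x lt_sp; first by rewrite subn0 w_p.
pose k := rev_ord (Ordinal lt_sp).
have kE : (p - s)%N = k.+1 by rewrite /= subnSK.
have N_gt0 := base_gt0 k x.
(* Invariant of the accumulation: partial sums up to [n]. At [n = N.-1], the result that
   [stage_operand] selects, the sum is complete. *)
have partial n : (n < N)%N -> nth 0 r ((s * M + x) * N + n) =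
    \sum_(j < N | (j <= n)%N) B (digit k x) j * w k.+1 (set_digit k x j) 0.
  elim: n => [|n IHn] lt_n;
    rewrite (recursion_program_nth (Ordinal lt_sp) x (Ordinal lt_n)) -/k;
    rewrite (bigD1 (Ordinal lt_n)) //= IH ?(ltnW lt_sp) // kE; congr (_ + _).
    rewrite big1 // => j /andP[]; rewrite leqn0 => /eqP j0.
    by rewrite -val_eqE /= j0.
  rewrite IHn ?(ltnW lt_n) //; apply: eq_bigl => j.
  by rewrite -val_eqE /= andbC -ltn_neqAle ltnS.
rewrite /= partial ?ltn_predL // -[(p - s.+1)%N]/(k : nat) w_step.
rewrite mul_kron_factor; apply: eq_bigl => j.
by rewrite -ltnS prednK // ltn_ord.
Qed.

End RecursionProgram.

Lemma computable_kron_pow (C : comPzRingType) N p (B : 'M[C]_N) :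
  computable_within B (fun v => kron_pow B p *m v) (N ^ p * p * N).
Proof.
exists (recursion_program N p), (stage_operand p).
split=> [|v]; first by rewrite size_recursion_program.
have [w w_rec] := exists_recursion B v.
apply/colP => i; rewrite mxE (stage_operand_value w_rec) // subnn.
by rewrite (recursion_kron_pow w_rec).
Qed.

(** * Growth of the operation count *)

Lemma exp_mul_bigO_ln (R : realType) (N : nat) : (2 <= N)%N ->
  (fun q : nat => (N ^ q * q * N)%:R : R) =O_\oo
    (fun q : nat => (N ^ q)%:R * ln (N ^ q)%:R).
Proof.
move=> N_ge2.
have lnN_gt0 : 0 < ln (N%:R : R) by rewrite ln_gt0 // ltr1n.
(* As [ln (N ^ q) = q * ln N], this constant is the exact ratio of the two sides, and [N >= 2] makes
   [ln N] positive. *)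
apply/eqO_exP; exists (N%:R / ln N%:R).
  by rewrite divr_gt0 // ltr0n (ltn_trans _ N_ge2).
apply: nearW => q.
rewrite natrX lnXn ?ltr0n ?(ltn_trans _ N_ge2) // !natrM natrX.
have -> : N%:R ^+ q * q%:R * N%:R =
    N%:R / ln N%:R * (N%:R ^+ q * (ln N%:R *+ q)) :> R.
  rewrite -[ln _ *+ q]mulr_natl (mulrA (_ ^+ q)) [RHS]mulrC.
  by rewrite -[RHS]mulrA [ln _ * _]mulrC divfK // gt_eqF.
by rewrite normrM ler_wpM2r // ger0_norm // divr_ge0 // ltW.
Qed.

Theorem mainTheorem8 (R : realType) (N p : nat) (hN : (2 <= N)%N)
    (hp : (1 <= p)%N) (A : 'M[R[i]]_N) (A_unitary : A \is unitarymx)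
    (A_row0 : forall i j : 'I_N, i = 0%N :> nat -> A i j = 1 / sqrtC N%:R) :
  let Abar := map_mx Num.conj A in
  [/\ kron_pow Abar p = \prod_(k < p) kron_factor Abar k,
      forall k : 'I_p,
        (forall i, (#|[pred j | kron_factor Abar k i j != 0%R]| <= N)%N) /\
        (forall j, (#|[pred i | kron_factor Abar k i j != 0%R]| <= N)%N),
      forall v : 'cV[R[i]]_(N ^ p),
        (exists w, recursion_of Abar v w) /\
        (forall w, recursion_of Abar v w -> w 0%N = kron_pow Abar p *m v),
      computable_within Abar (fun v => kron_pow Abar p *m v) (N ^ p * p * N) &
      (fun q : nat => (N ^ q * q * N)%:R : R) =O_\oo
        (fun q : nat => (N ^ q)%:R * ln (N ^ q)%:R)].
Proof.
move=> Abar; split.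
- exact: kron_pow_factorization.
- by move=> k; split=> i;
    [apply: kron_factor_row_support | apply: kron_factor_col_support].
- move=> v; split; first exact: exists_recursion.
  by move=> w; apply: recursion_kron_pow.
- exact: computable_kron_pow.
- exact: exp_mul_bigO_ln.
Qed.
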